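(* Every Markov category is comonoid equivalent to a strict Markov category.
   Context: A Markov category is a symmetric monoidal category $(\mathsf{C},\otimes,I)$ with symmetry $\mathsf{swap}_{X,Y}:X\otimes Y\to Y\otimes X$, in which every object $X$ is equipped with morphisms $\mathsf{copy}_X:X\to X\otimes X$ and $\mathsf{del}_X:X\to I$ forming a commutative comonoid (coassociative, counital, cocommutative, with respect to the associators, unitors and symmetry), such that: (i) $\mathsf{del}_{X\otimes Y}$ is $\mathsf{del}_X\otimes\mathsf{del}_Y$ followed by $I\otimes I\cong I$; (ii) $\mathsf{copy}_{X\otimes Y}$ is $\mathsf{copy}_X\otimes\mathsf{copy}_Y$ followed by the canonical isomorphism $(X\otimes X)\otimes(Y\otimes Y)\cong(X\otimes Y)\otimes(X\otimes Y)$ built from associators and the symmetry on the two middle factors; (iii) $\mathsf{del}_Y\circ f=\mathsf{del}_X$ for every $f:X\to Y$. A Markov category is strict if its underlying monoidal category is strict. A morphism $f:X\to Y$ in a Markov category is deterministic if $\mathsf{copy}_Y\circ f=(f\otimes f)\circ\mathsf{copy}_X$. The 2-category $\mathsf{Markov}$ has: as objects, Markov categories; as 1-morphisms $F:\mathsf{C}\to\mathsf{D}$, Markov functors, i.e. strong symmetric monoidal functors such that for every $X\in\mathsf{C}$ the composite of $\mathsf{copy}_{FX}:FX\to FX\otimes FX$ with the structure isomorphism $FX\otimes FX\cong F(X\otimes X)$ of $F$ equals $F(\mathsf{copy}_X)$; as 2-morphisms $F\Rightarrow G$, monoidal natural transformations all of whose components are deterministic. A functor is a comonoid equivalence if it is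 an equivalence in the 2-category $\mathsf{Markov}$; two Markov categories are comonoid equivalent if there is a comonoid equivalence between them. *)

(* Defs.v *)
Set Implicit Arguments.
Unset Strict Implicit.
Unset Printing Implicit Defensive.

Declare Scope cat_ob_scope.
Declare Scope cat_hom_scope.
Delimit Scope cat_ob_scope with ob.
Delimit Scope cat_hom_scope with hom.

Record Category := {
  Ob :> Type;
  Hom : Ob -> Ob -> Type;
  id : forall X, Hom X X;
  comp : forall X Y Z, Hom Y Z -> Hom X Y -> Hom X Z;
  comp_id_l : forall X Y (f : Hom X Y), comp (id Y) f = f;
  comp_id_r : forall X Y (f : Hom X Y), comp f (id X) = f;
  comp_assoc : forall W X Y Z (h : Hom Y Z) (g : Hom X Y) (f : Hom W X),
    comp h (comp g f) = comp (comp h g) f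
}.

Arguments Hom {c} X Y.
Arguments id {c} X.
Arguments comp {c X Y Z} g f.
Arguments comp_id_l {c X Y} f.
Arguments comp_id_r {c X Y} f.
Arguments comp_assoc {c W X Y Z} h g f.

Bind Scope cat_ob_scope with Ob.
Bind Scope cat_hom_scope with Hom.

Notation "g ∘ f" := (comp g f) (at level 40, left associativity) : cat_hom_scope.
Open Scope cat_ob_scope.
Open Scope cat_hom_scope.

Record Iso (C : Category) (X Y : C) := {
  iso_hom :> Hom X Y;
  iso_inv : Hom Y X;
  iso_inv_hom : iso_inv ∘ iso_hom = id X;
  iso_hom_inv : iso_hom ∘ iso_inv = id Y
}.

Arguments iso_inv {C X Y} i.

Definition eq_to_hom (C : Category) (X Y : C) (e : X = Y) : Hom X Y :=
  match e in _ = Z return Hom X Z with eq_refl => id X end.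

Definition iso_id (C : Category) (X : C) : Iso X X :=
  {| iso_hom := id X; iso_inv := id X;
     iso_inv_hom := comp_id_l (id X); iso_hom_inv := comp_id_l (id X) |}.

Definition iso_comp (C : Category) (X Y Z : C) (g : Iso Y Z) (f : Iso X Y) :
  Iso X Z.
Proof.
refine {| iso_hom := g ∘ f; iso_inv := iso_inv f ∘ iso_inv g |}.
- rewrite comp_assoc, <- (comp_assoc (iso_inv f)), iso_inv_hom, comp_id_r.
  apply iso_inv_hom.
- rewrite comp_assoc, <- (comp_assoc (iso_hom g)), iso_hom_inv, comp_id_r.
  apply iso_hom_inv.
Defined.

Record Functor (C D : Category) := {
  fob :> C -> D;
  fmap : forall X Y : C, Hom X Y -> Hom (fob X) (fob Y);
  fmap_id : forall X, fmap (id X) = id (fob X);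
  fmap_comp : forall X Y Z (g : Hom Y Z) (f : Hom X Y),
    fmap (g ∘ f) = fmap g ∘ fmap f
}.

Arguments fmap {C D} F {X Y} f : rename.

Definition functor_id (C : Category) : Functor C C :=
  {| fob := fun X => X; fmap := fun _ _ f => f;
     fmap_id := fun _ => eq_refl; fmap_comp := fun _ _ _ _ _ => eq_refl |}.

Definition functor_comp (C D E : Category) (G : Functor D E) (F : Functor C D) :
  Functor C E.
Proof.
refine {| fob := fun X => G (F X); fmap := fun _ _ f => fmap G (fmap F f) |}.
- intros X; rewrite !fmap_id; reflexivity.
- intros X Y Z g f; rewrite !fmap_comp; reflexivity.
Defined.

Definition iso_map (C D : Category) (F : Functor C D) (X Y : C) (i : Iso X Y) :
  Iso (F X) (F Y).
Proof.
refine {| iso_hom := fmap F i; iso_inv := fmap F (iso_inv i) |}.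
- rewrite <- fmap_comp, iso_inv_hom; apply fmap_id.
- rewrite <- fmap_comp, iso_hom_inv; apply fmap_id.
Defined.

Record MonoidalCategory := {
  mon_cat :> Category;
  unit : mon_cat;
  tensor : mon_cat -> mon_cat -> mon_cat;
  tensor_hom : forall X X' Y Y' : mon_cat,
    Hom X X' -> Hom Y Y' -> Hom (tensor X Y) (tensor X' Y');
  tensor_id : forall X Y, tensor_hom (id X) (id Y) = id (tensor X Y);
  tensor_comp : forall X X' X'' Y Y' Y'' : mon_cat,
    forall (f' : Hom X' X'') (f : Hom X X') (g' : Hom Y' Y'') (g : Hom Y Y'),
    tensor_hom (f' ∘ f) (g' ∘ g) = tensor_hom f' g' ∘ tensor_hom f g;
  assoc : forall X Y Z, Iso (tensor (tensor X Y) Z) (tensor X (tensor Y Z));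
  lunit : forall X, Iso (tensor unit X) X;
  runit : forall X, Iso (tensor X unit) X;
  assoc_nat : forall X X' Y Y' Z Z' : mon_cat,
    forall (f : Hom X X') (g : Hom Y Y') (h : Hom Z Z'),
    assoc X' Y' Z' ∘ tensor_hom (tensor_hom f g) h
    = tensor_hom f (tensor_hom g h) ∘ assoc X Y Z;
  lunit_nat : forall (X X' : mon_cat) (f : Hom X X'),
    lunit X' ∘ tensor_hom (id unit) f = f ∘ lunit X;
  runit_nat : forall (X X' : mon_cat) (f : Hom X X'),
    runit X' ∘ tensor_hom f (id unit) = f ∘ runit X;
  pentagon : forall W X Y Z,
    tensor_hom (id W) (assoc X Y Z) ∘ assoc W (tensor X Y) Z
      ∘ tensor_hom (assoc W X Y) (id Z)
    = assoc W X (tensor Y Z) ∘ assoc (tensor W X) Y Z;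
  triangle : forall X Y,
    tensor_hom (id X) (lunit Y) ∘ assoc X unit Y
    = tensor_hom (runit X) (id Y)
}.

Arguments unit {m}.
Arguments tensor {m} X Y.
Arguments tensor_hom {m X X' Y Y'} f g.
Arguments assoc {m} X Y Z.
Arguments lunit {m} X.
Arguments runit {m} X.

Notation "X ⊗ Y" := (tensor X Y)
  (at level 35, right associativity) : cat_ob_scope.
Notation "f ⊗ g" := (tensor_hom f g)
  (at level 35, right associativity) : cat_hom_scope.

Record SymMonCategory := {
  sym_mon :> MonoidalCategory;
  swap : forall X Y : sym_mon, Hom (X ⊗ Y)%ob (Y ⊗ X)%ob;
  swap_nat : forall (X X' Y Y' : sym_mon) (f : Hom X X') (g : Hom Y Y'),
    swap X' Y' ∘ (f ⊗ g) = (g ⊗ f) ∘ swap X Y;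
  swap_swap : forall X Y, swap Y X ∘ swap X Y = id (X ⊗ Y)%ob;
  hexagon : forall X Y Z,
    assoc Y Z X ∘ swap X (Y ⊗ Z)%ob ∘ assoc X Y Z
    = (id Y ⊗ swap X Z) ∘ assoc Y X Z ∘ (swap X Y ⊗ id Z)
}.

Arguments swap {s} X Y.

Definition exchange (C : SymMonCategory) (X Y Z W : C) :
  Hom ((X ⊗ Y) ⊗ (Z ⊗ W))%ob ((X ⊗ Z) ⊗ (Y ⊗ W))%ob :=
  iso_inv (assoc X Z (Y ⊗ W)%ob)
  ∘ (id X ⊗ (assoc Z Y W ∘ (swap Y Z ⊗ id W) ∘ iso_inv (assoc Y Z W)))
  ∘ assoc X Y (Z ⊗ W)%ob.

Record MarkovCategory := {
  markov_sym :> SymMonCategory;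
  copy : forall X : markov_sym, Hom X (X ⊗ X)%ob;
  del : forall X : markov_sym, Hom X unit;
  copy_coassoc : forall X,
    assoc X X X ∘ (copy X ⊗ id X) ∘ copy X = (id X ⊗ copy X) ∘ copy X;
  copy_counit_l : forall X, lunit X ∘ (del X ⊗ id X) ∘ copy X = id X;
  copy_counit_r : forall X, runit X ∘ (id X ⊗ del X) ∘ copy X = id X;
  copy_cocomm : forall X, swap X X ∘ copy X = copy X;
  del_tensor : forall X Y, del (X ⊗ Y)%ob = lunit unit ∘ (del X ⊗ del Y);
  copy_tensor : forall X Y,
    copy (X ⊗ Y)%ob = exchange X X Y Y ∘ (copy X ⊗ copy Y);
  del_nat : forall (X Y : markov_sym) (f : Hom X Y), del Y ∘ f = del X
}.

Arguments copy {m} X.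
Arguments del {m} X.

Definition deterministic (C : MarkovCategory) (X Y : C) (f : Hom X Y) : Prop :=
  copy Y ∘ f = (f ⊗ f) ∘ copy X.

(** The tensor product of objects is associative and unital on the
    nose, and the structure isomorphisms are identities.  By naturality of the
    latter, the tensor product of morphisms is then strictly associative and
    unital as well. *)
Definition strict_monoidal (C : MonoidalCategory) : Prop :=
  (forall X Y Z : C, exists e : ((X ⊗ Y) ⊗ Z)%ob = (X ⊗ (Y ⊗ Z))%ob,
     iso_hom (assoc X Y Z) = eq_to_hom e) /\
  (forall X : C, exists e : (unit ⊗ X)%ob = X,
     iso_hom (lunit X) = eq_to_hom e) /\
  (forall X : C, exists e : (X ⊗ unit)%ob = X,
     iso_hom (runit X) = eq_to_hom e).

Definition strict_markov (C : MarkovCategory) : Prop := strict_monoidal C.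

Record SymMonFunctor (C D : SymMonCategory) := {
  smf_functor :> Functor C D;
  smf_mu : forall X Y : C,
    Iso (smf_functor X ⊗ smf_functor Y)%ob (smf_functor (X ⊗ Y)%ob);
  smf_eps : Iso unit (smf_functor unit);
  smf_mu_nat : forall (X X' Y Y' : C) (f : Hom X X') (g : Hom Y Y'),
    smf_mu X' Y' ∘ (fmap smf_functor f ⊗ fmap smf_functor g)
    = fmap smf_functor (f ⊗ g) ∘ smf_mu X Y;
  smf_assoc : forall X Y Z : C,
    fmap smf_functor (assoc X Y Z) ∘ smf_mu (X ⊗ Y)%ob Z
      ∘ (smf_mu X Y ⊗ id (smf_functor Z))
    = smf_mu X (Y ⊗ Z)%ob ∘ (id (smf_functor X) ⊗ smf_mu Y Z)
      ∘ assoc (smf_functor X) (smf_functor Y) (smf_functor Z);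
  smf_lunit : forall X : C,
    fmap smf_functor (lunit X) ∘ smf_mu unit X
      ∘ (smf_eps ⊗ id (smf_functor X))
    = lunit (smf_functor X);
  smf_runit : forall X : C,
    fmap smf_functor (runit X) ∘ smf_mu X unit
      ∘ (id (smf_functor X) ⊗ smf_eps)
    = runit (smf_functor X);
  smf_swap : forall X Y : C,
    fmap smf_functor (swap X Y) ∘ smf_mu X Y
    = smf_mu Y X ∘ swap (smf_functor X) (smf_functor Y)
}.

Arguments smf_mu {C D} F X Y : rename.
Arguments smf_eps {C D} F : rename.

Record MarkovFunctor (C D : MarkovCategory) := {
  mf_smf :> SymMonFunctor C D;
  mf_copy : forall X : C,
    smf_mu mf_smf X X ∘ copy (mf_smf X) = fmap mf_smf (copy X)
}.

Definition smf_id (C : SymMonCategory) : SymMonFunctor C C.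
Proof.
refine {| smf_functor := functor_id C;
          smf_mu := fun X Y : C => iso_id (X ⊗ Y)%ob;
          smf_eps := iso_id (unit : C) |};
  cbn; intros;
  repeat first [rewrite tensor_id | rewrite comp_id_l | rewrite comp_id_r];
  reflexivity.
Defined.

Definition mf_id (C : MarkovCategory) : MarkovFunctor C C.
Proof.
refine {| mf_smf := smf_id C |}.
intros X; apply comp_id_l.
Defined.

Lemma tensor_comp_id_r (C : MonoidalCategory) (X Y Z W : C)
    (g : Hom Y Z) (f : Hom X Y) :
  (g ∘ f) ⊗ id W = (g ⊗ id W) ∘ (f ⊗ id W).
Proof. rewrite <- tensor_comp, comp_id_l; reflexivity. Qed.

Lemma tensor_comp_id_l (C : MonoidalCategory) (X Y Z W : C)
    (g : Hom Y Z) (f : Hom X Y) :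
  id W ⊗ (g ∘ f) = (id W ⊗ g) ∘ (id W ⊗ f).
Proof. rewrite <- tensor_comp, comp_id_l; reflexivity. Qed.

Definition smf_comp (C D E : SymMonCategory) (G : SymMonFunctor D E)
    (F : SymMonFunctor C D) : SymMonFunctor C E.
Proof.
refine {| smf_functor := functor_comp G F;
  smf_mu := fun X Y => iso_comp (iso_map G (smf_mu F X Y)) (smf_mu G (F X) (F Y));
  smf_eps := iso_comp (iso_map G (smf_eps F)) (smf_eps G) |}; cbn.
- intros X X' Y Y' f g.
  rewrite <- comp_assoc, (smf_mu_nat G), !comp_assoc, <- !fmap_comp.
  rewrite (smf_mu_nat F); reflexivity.
- intros X Y Z.
  rewrite tensor_comp_id_r, tensor_comp_id_l.
  rewrite <- (fmap_id G (F Z)), <- (fmap_id G (F X)).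
  rewrite !comp_assoc.
  rewrite <- (comp_assoc _ (smf_mu G (F (X ⊗ Y)%ob) (F Z))), smf_mu_nat.
  rewrite <- (comp_assoc _ (smf_mu G (F X) (F (Y ⊗ Z)%ob))), smf_mu_nat.
  rewrite !comp_assoc, <- !fmap_comp.
  rewrite (smf_assoc F), !fmap_comp, !fmap_id, <- !comp_assoc.
  do 2 f_equal.
  rewrite !comp_assoc; apply smf_assoc.
- intros X.
  rewrite tensor_comp_id_r, <- (fmap_id G (F X)), !comp_assoc.
  rewrite <- (comp_assoc _ (smf_mu G (F unit) (F X))), smf_mu_nat.
  rewrite !comp_assoc, <- !fmap_comp, (smf_lunit F), fmap_id.
  apply smf_lunit.
- intros X.
  rewrite tensor_comp_id_l, <- (fmap_id G (F X)), !comp_assoc.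
  rewrite <- (comp_assoc _ (smf_mu G (F X) (F unit))), smf_mu_nat.
  rewrite !comp_assoc, <- !fmap_comp, (smf_runit F), fmap_id.
  apply smf_runit.
- intros X Y.
  rewrite comp_assoc, <- fmap_comp, (smf_swap F), fmap_comp, <- !comp_assoc.
  f_equal; apply smf_swap.
Defined.

Definition mf_comp (C D E : MarkovCategory) (G : MarkovFunctor D E)
    (F : MarkovFunctor C D) : MarkovFunctor C E.
Proof.
refine {| mf_smf := smf_comp G F |}.
intros X; cbn.
rewrite <- comp_assoc, (mf_copy G), <- fmap_comp, (mf_copy F); reflexivity.
Defined.

Record MonTrans (C D : SymMonCategory) (F G : SymMonFunctor C D) := {
  mt_app :> forall X : C, Hom (F X) (G X);
  mt_nat : forall (X Y : C) (f : Hom X Y),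
    mt_app Y ∘ fmap F f = fmap G f ∘ mt_app X;
  mt_tensor : forall X Y : C,
    mt_app (X ⊗ Y)%ob ∘ smf_mu F X Y = smf_mu G X Y ∘ (mt_app X ⊗ mt_app Y);
  mt_unit : mt_app unit ∘ smf_eps F = smf_eps G
}.

Record MarkovTrans (C D : MarkovCategory) (F G : MarkovFunctor C D) := {
  mkt_trans :> MonTrans F G;
  mkt_det : forall X : C, deterministic (mkt_trans X)
}.

Definition mt_id (C D : SymMonCategory) (F : SymMonFunctor C D) : MonTrans F F.
Proof.
refine {| mt_app := fun X => id (F X) |}; intros;
  rewrite ?tensor_id, comp_id_l, ?comp_id_r; reflexivity.
Defined.

Definition mkt_id (C D : MarkovCategory) (F : MarkovFunctor C D) :
  MarkovTrans F F.
Proof.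
refine {| mkt_trans := mt_id F |}.
intros X; red; cbn; rewrite tensor_id, comp_id_l, comp_id_r; reflexivity.
Defined.

Definition mt_comp (C D : SymMonCategory) (F G H : SymMonFunctor C D)
    (b : MonTrans G H) (a : MonTrans F G) : MonTrans F H.
Proof.
refine {| mt_app := fun X => b X ∘ a X |}.
- intros X Y f.
  rewrite <- comp_assoc, mt_nat, comp_assoc, mt_nat, comp_assoc; reflexivity.
- intros X Y.
  rewrite <- comp_assoc, mt_tensor, comp_assoc, mt_tensor, tensor_comp, comp_assoc.
  reflexivity.
- rewrite <- comp_assoc, mt_unit; apply mt_unit.
Defined.

Definition mkt_comp (C D : MarkovCategory) (F G H : MarkovFunctor C D)
    (b : MarkovTrans G H) (a : MarkovTrans F G) : MarkovTrans F H.
Proof.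
refine {| mkt_trans := mt_comp b a |}.
intros X; red; cbn.
rewrite comp_assoc, (mkt_det b X), <- comp_assoc, (mkt_det a X), tensor_comp.
apply comp_assoc.
Defined.

Definition isomorphic_1mor (C D : MarkovCategory) (F G : MarkovFunctor C D) :
  Prop :=
  exists (a : MarkovTrans F G) (b : MarkovTrans G F),
    mkt_comp b a = mkt_id F /\ mkt_comp a b = mkt_id G.

Definition comonoid_equivalence (C D : MarkovCategory) (F : MarkovFunctor C D) :
  Prop :=
  exists G : MarkovFunctor D C,
    isomorphic_1mor (mf_id C) (mf_comp G F) /\
    isomorphic_1mor (mf_comp F G) (mf_id D).

Definition comonoid_equivalent (C D : MarkovCategory) : Prop :=
  exists F : MarkovFunctor C D, comonoid_equivalence F.

(* Main.v *)
(** The strictification [D] has as objects the finite words in objects of [C],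
    a morphism between words being a morphism of [C] between their right-nested
    tensor products.  All structure of [D] is that of [C] conjugated by the
    canonical isomorphisms [mu : ev l ⊗ ev m -> ev (l ++ m)], so its axioms are
    inherited, and an induction on words shows that its associators and unitors
    are casts along the monoid laws.  For [copy_tensor] in [D], the map
    [mu] has to be deterministic; this reduces to determinism of the associators
    and unitors of [C], that is, to coherence identities for [exchange].
    The quasi-inverse of evaluation sends [X] to the one-letter word [X], with
    comparison [runit X : X ⊗ unit -> X]. *)

Require Import Defs.
From Stdlib Require Import Setoid ProofIrrelevance FunctionalExtensionality.

Set Implicit Arguments.
Unset Strict Implicit.
Unset Printing Implicit Defensive.

(** * Coherence in monoidal categories *)

Section Isomorphisms.
Context {C : Category}.

Definition iso_sym (X Y : C) (i : Iso X Y) : Iso Y X :=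
  {| iso_hom := iso_inv i; iso_inv := i;
     iso_inv_hom := iso_hom_inv i; iso_hom_inv := iso_inv_hom i |}.

(** With composites kept nested to the right, a law about two adjacent factors matches only at the
    end of the chain. This form and [whisker3] carry the remaining tail [t] along, so such a law can
    be rewritten anywhere. *)
Lemma whisker2 (W X Y Z : C) (g : Hom Y Z) (f : Hom X Y) (k : Hom X Z) :
  g ∘ f = k -> forall t : Hom W X, g ∘ (f ∘ t) = k ∘ t.
Proof. intros <- t; apply comp_assoc. Qed.

Lemma whisker3 (V W X Y Z : C) (h : Hom Y Z) (g : Hom X Y) (f : Hom W X)
    (k : Hom W Z) :
  h ∘ (g ∘ f) = k -> forall t : Hom V W, h ∘ (g ∘ (f ∘ t)) = k ∘ t.
Proof. intros <- t; rewrite <- !comp_assoc; reflexivity. Qed.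

Lemma iso_inv_cancel (W X Y : C) (i : Iso X Y) (f : Hom W X) :
  iso_inv i ∘ (i ∘ f) = f.
Proof. rewrite comp_assoc, iso_inv_hom; apply comp_id_l. Qed.

Lemma iso_hom_cancel (W X Y : C) (i : Iso X Y) (f : Hom W Y) :
  i ∘ (iso_inv i ∘ f) = f.
Proof. rewrite comp_assoc, iso_hom_inv; apply comp_id_l. Qed.

Lemma iso_monic (W X Y : C) (i : Iso X Y) (f g : Hom W X) :
  i ∘ f = i ∘ g -> f = g.
Proof.
  intros H; rewrite <- (iso_inv_cancel i f), H; apply iso_inv_cancel.
Qed.

Lemma iso_epic (X Y Z : C) (i : Iso X Y) (f g : Hom Y Z) :
  f ∘ i = g ∘ i -> f = g.
Proof.
  intros H.
  rewrite <- (comp_id_r f), <- (iso_hom_inv i), comp_assoc, H, <- comp_assoc.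
  rewrite iso_hom_inv; apply comp_id_r.
Qed.

End Isomorphisms.

Arguments iso_inv_cancel {C W X Y} i f.
Arguments iso_hom_cancel {C W X Y} i f.
Arguments iso_monic {C W X Y} i f g _.
Arguments iso_epic {C X Y Z} i f g _.
Arguments whisker2 {C W X Y Z g f k} _ t.
Arguments whisker3 {C V W X Y Z h g f k} _ t.

Ltac assoc_r := rewrite <- ?comp_assoc.


Section Monoidal.
Context {C : MonoidalCategory}.

Definition iso_tensor (X X' Y Y' : C) (i : Iso X X') (j : Iso Y Y') :
  Iso (X ⊗ Y)%ob (X' ⊗ Y')%ob.
Proof.
  refine {| iso_hom := i ⊗ j; iso_inv := iso_inv i ⊗ iso_inv j |};
  rewrite <- tensor_comp, ?iso_inv_hom, ?iso_hom_inv; apply tensor_id.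
Defined.

Lemma tensor_split_l (X X' Y Y' : C) (f : Hom X X') (g : Hom Y Y') :
  f ⊗ g = (f ⊗ id Y') ∘ (id X ⊗ g).
Proof. rewrite <- tensor_comp, comp_id_l, comp_id_r; reflexivity. Qed.

Lemma tensor_split_r (X X' Y Y' : C) (f : Hom X X') (g : Hom Y Y') :
  f ⊗ g = (id X' ⊗ g) ∘ (f ⊗ id Y).
Proof. rewrite <- tensor_comp, comp_id_l, comp_id_r; reflexivity. Qed.

Lemma tensor_comp_l (X Y Z W W' : C) (g : Hom Y Z) (f : Hom X Y) (h : Hom W W') :
  (g ∘ f) ⊗ h = (g ⊗ id W') ∘ (f ⊗ h).
Proof. rewrite <- tensor_comp, comp_id_l; reflexivity. Qed.

Lemma tensor_comp_r (X Y Z W W' : C) (g : Hom Y Z) (f : Hom X Y) (h : Hom W W') :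
  h ⊗ (g ∘ f) = (id W' ⊗ g) ∘ (h ⊗ f).
Proof. rewrite <- tensor_comp, comp_id_l; reflexivity. Qed.

(** [lunit] is a natural isomorphism from [unit ⊗ -] to the identity functor. *)
Lemma unit_tensor_faithful (X Y : C) (f g : Hom X Y) :
  id (unit : C) ⊗ f = id unit ⊗ g -> f = g.
Proof.
  intros H; apply (iso_epic (lunit X)); rewrite <- !lunit_nat, H; reflexivity.
Qed.

Lemma tensor_unit_faithful (X Y : C) (f g : Hom X Y) :
  f ⊗ id (unit : C) = g ⊗ id unit -> f = g.
Proof.
  intros H; apply (iso_epic (runit X)); rewrite <- !runit_nat, H; reflexivity.
Qed.

(** Kelly's argument: it suffices to compare both sides after applying [id unit ⊗ -]. Precomposed
    with two associators, they become equal by [pentagon], [triangle] and naturality of [assoc]. *)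
Lemma lunit_tensor (X Y : C) :
  lunit (X ⊗ Y)%ob ∘ assoc unit X Y = lunit X ⊗ id Y.
Proof.
  apply unit_tensor_faithful.
  apply (iso_epic (assoc unit (unit ⊗ X)%ob Y)).
  apply (iso_epic (iso_tensor (assoc unit unit X) (iso_id Y))); cbn.
  rewrite tensor_comp_id_l; assoc_r.
  rewrite (comp_assoc _ (assoc unit (unit ⊗ X)%ob Y)), pentagon.
  rewrite comp_assoc, triangle, <- (tensor_id X Y).
  rewrite <- assoc_nat, comp_assoc, <- (assoc_nat (id unit) (lunit X) (id Y)); assoc_r.
  rewrite <- tensor_comp_id_r, triangle; reflexivity.
Qed.

Lemma runit_tensor (X Y : C) :
  (id X ⊗ runit Y) ∘ assoc X Y unit = runit (X ⊗ Y)%ob.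
Proof.
  apply tensor_unit_faithful, (iso_monic (assoc X Y unit)).
  rewrite <- (triangle (X ⊗ Y)%ob unit), <- tensor_id, comp_assoc, assoc_nat.
  rewrite <- comp_assoc, <- pentagon, !comp_assoc, <- tensor_comp_id_l, triangle.
  rewrite tensor_comp_id_r, comp_assoc, assoc_nat; reflexivity.
Qed.

(** Naturality of [lunit] at the morphism [lunit X] itself, with the outer [lunit X] cancelled. *)
Lemma lunit_lunit (X : C) : iso_hom (lunit (unit ⊗ X)%ob) = id unit ⊗ lunit X.
Proof. apply (iso_monic (lunit X)); symmetry; apply lunit_nat. Qed.

(** After tensoring with [id unit], both sides equal [(id unit ⊗ lunit unit) ∘ assoc unit unit
    unit]: one by [lunit_tensor], the other by [triangle]. *)
Lemma lunit_runit_unit : iso_hom (lunit (unit : C)) = runit unit.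
Proof.
  apply tensor_unit_faithful.
  rewrite <- lunit_tensor, lunit_lunit; apply triangle.
Qed.

Lemma assoc_inv_nat (X X' Y Y' Z Z' : C)
    (f : Hom X X') (g : Hom Y Y') (h : Hom Z Z') :
  iso_inv (assoc X' Y' Z') ∘ (f ⊗ (g ⊗ h))
  = ((f ⊗ g) ⊗ h) ∘ iso_inv (assoc X Y Z).
Proof.
  apply (iso_monic (assoc X' Y' Z')).
  rewrite iso_hom_cancel, comp_assoc, assoc_nat; assoc_r.
  rewrite iso_hom_inv, comp_id_r; reflexivity.
Qed.

End Monoidal.

(** * Coherence of the exchange morphism *)

Section Symmetric.
Context {C : SymMonCategory}.

(* In a composite of such maps everything is nested to the right, so that
   associators only appear at the ends. *)
Definition swap_head (X Y W : C) : Hom (X ⊗ Y ⊗ W)%ob (Y ⊗ X ⊗ W)%ob :=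
  assoc Y X W ∘ (swap X Y ⊗ id W) ∘ iso_inv (assoc X Y W).

(** Moves the inverse associator of [exchange] to the other side, so that identities for [exchange]
    reduce to identities for [swap_head]. *)
Lemma exchange_swap_head (X Y Z W : C) :
  assoc X Z (Y ⊗ W)%ob ∘ exchange X Y Z W
  = (id X ⊗ swap_head Y Z W) ∘ assoc X Y (Z ⊗ W)%ob.
Proof. unfold exchange, swap_head; assoc_r; apply iso_hom_cancel. Qed.

Lemma swap_head_assoc (X Y W : C) :
  swap_head X Y W ∘ assoc X Y W = assoc Y X W ∘ (swap X Y ⊗ id W).
Proof.
  unfold swap_head; assoc_r; rewrite iso_inv_hom, comp_id_r; reflexivity.
Qed.

Lemma swap_head_nat (X X' Y Y' W W' : C)
    (f : Hom X X') (g : Hom Y Y') (h : Hom W W') :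
  swap_head X' Y' W' ∘ (f ⊗ (g ⊗ h)) = (g ⊗ (f ⊗ h)) ∘ swap_head X Y W.
Proof.
  unfold swap_head; assoc_r.
  rewrite assoc_inv_nat, (comp_assoc (swap X' Y' ⊗ _)), <- tensor_comp, swap_nat.
  rewrite (comp_assoc (g ⊗ _)), <- assoc_nat; assoc_r.
  rewrite (whisker2 (eq_sym (tensor_comp _ _ _ _))), comp_id_l, comp_id_r.
  reflexivity.
Qed.

Lemma swap_head_swap_head (X Y W : C) :
  swap_head Y X W ∘ swap_head X Y W = id _.
Proof.
  unfold swap_head; assoc_r; rewrite iso_inv_cancel.
  rewrite (comp_assoc (swap Y X ⊗ _)), <- tensor_comp_id_r, swap_swap, tensor_id.
  rewrite comp_id_l; apply iso_hom_inv.
Qed.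

Definition swap_head_iso (X Y W : C) : Iso (X ⊗ Y ⊗ W)%ob (Y ⊗ X ⊗ W)%ob :=
  {| iso_hom := swap_head X Y W; iso_inv := swap_head Y X W;
     iso_inv_hom := swap_head_swap_head X Y W;
     iso_hom_inv := swap_head_swap_head Y X W |}.

Lemma swap_head_tensor (X Y W V : C) :
  (id Y ⊗ assoc X W V) ∘ assoc Y (X ⊗ W)%ob V ∘ (swap_head X Y W ⊗ id V)
  = swap_head X Y (W ⊗ V)%ob ∘ (id X ⊗ assoc Y W V) ∘ assoc X (Y ⊗ W)%ob V.
Proof.
  apply (iso_epic (iso_tensor (assoc X Y W) (iso_id V))); cbn; assoc_r.
  rewrite <- tensor_comp_id_r, swap_head_assoc, tensor_comp_id_r.
  rewrite (whisker3 (eq_trans (comp_assoc _ _ _) (pentagon Y X W V))).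
  rewrite (comp_assoc (id X ⊗ _)), pentagon; assoc_r.
  rewrite assoc_nat, tensor_id, (comp_assoc (swap_head _ _ _)), swap_head_assoc.
  assoc_r; reflexivity.
Qed.

(** The hexagon with a spectator [W]: the pentagons move [W] out of the way, and [hexagon] is
    applied in the first tensor factor. *)
Lemma swap_head_hexagon (X Y Z W : C) :
  assoc Y Z (X ⊗ W)%ob ∘ swap_head X (Y ⊗ Z)%ob W
  = (id Y ⊗ swap_head X Z W) ∘ swap_head X Y (Z ⊗ W)%ob ∘ (id X ⊗ assoc Y Z W).
Proof.
  apply (iso_epic (assoc X (Y ⊗ Z)%ob W)).
  apply (iso_epic (iso_tensor (assoc X Y Z) (iso_id W))); cbn; assoc_r.
  rewrite (whisker2 (swap_head_assoc _ _ _)); assoc_r.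
  rewrite (comp_assoc (id X ⊗ _)), pentagon.
  rewrite (whisker2 (eq_sym (pentagon Y Z X W))); assoc_r.
  rewrite (whisker2 (swap_head_assoc X Y _)); assoc_r.
  rewrite <- (tensor_id Z W), <- assoc_nat.
  rewrite (whisker2 (eq_sym (pentagon Y X Z W))); assoc_r.
  rewrite (whisker2 (eq_sym (tensor_comp_id_l _ _ _))), swap_head_assoc.
  rewrite <- !tensor_comp_id_r, (comp_assoc (assoc Y Z X)), hexagon.
  rewrite !tensor_comp_id_r, tensor_comp_id_l; assoc_r.
  rewrite (whisker2 (assoc_nat _ _ _)); assoc_r; reflexivity.
Qed.

(** The second hexagon is the inverse of the first, because [swap_head] is inverse to itself with
    the arguments exchanged. *)
Lemma swap_head_hexagon_l (X Y Z W : C) :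
  (id Z ⊗ assoc X Y W) ∘ swap_head (X ⊗ Y)%ob Z W
  = swap_head X Z (Y ⊗ W)%ob ∘ (id X ⊗ swap_head Y Z W) ∘ assoc X Y (Z ⊗ W)%ob.
Proof.
  apply (iso_epic (swap_head_iso Z (X ⊗ Y)%ob W)); cbn; assoc_r.
  rewrite swap_head_swap_head, swap_head_hexagon, comp_id_r; assoc_r.
  rewrite (whisker2 (eq_sym (tensor_comp_id_l _ _ _))), swap_head_swap_head.
  rewrite tensor_id, comp_id_l, comp_assoc, swap_head_swap_head, comp_id_l.
  reflexivity.
Qed.

Lemma lunit_swap_head (X W : C) :
  lunit (X ⊗ W)%ob ∘ swap_head X unit W = id X ⊗ lunit W.
Proof.
  (* With [u W := lunit ∘ swap_head X unit W], hexagon and naturality give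
     [u V ∘ (id X ⊗ lunit) = u V ∘ u (unit ⊗ V)]; cancel the invertible [u V]. *)
  assert (H : forall V, lunit (X ⊗ unit ⊗ V)%ob ∘ swap_head X unit (unit ⊗ V)%ob
      = id X ⊗ lunit (unit ⊗ V)%ob).
  { intros V.
    apply (iso_epic (iso_tensor (iso_id X) (assoc unit unit V))).
    apply (iso_monic (iso_comp (lunit (X ⊗ V)%ob) (swap_head_iso X unit V))).
    cbn; assoc_r.
    rewrite <- tensor_comp_id_l, lunit_tensor, swap_head_nat, tensor_id.
    rewrite <- (lunit_tensor unit), lunit_lunit; assoc_r.
    rewrite swap_head_hexagon; assoc_r.
    rewrite (comp_assoc (swap_head X unit V)), <- lunit_nat, lunit_lunit.
    assoc_r; reflexivity. }
  (* [H] covers the tails [unit ⊗ V]. Naturality along the invertible [lunit W] extends it to an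
     arbitrary tail [W]. *)
  apply (iso_epic (iso_tensor (iso_id X) (iso_tensor (iso_id unit) (lunit W)))).
  cbn; assoc_r.
  rewrite swap_head_nat, comp_assoc, lunit_nat; assoc_r.
  rewrite H, <- !tensor_comp_id_l, lunit_nat; reflexivity.
Qed.

Lemma swap_head_lunit (X W : C) :
  (id X ⊗ lunit W) ∘ swap_head unit X W = lunit (X ⊗ W)%ob.
Proof.
  rewrite <- lunit_swap_head; assoc_r.
  rewrite swap_head_swap_head; apply comp_id_r.
Qed.

Lemma exchange_nat (X X' Y Y' Z Z' W W' : C) (f : Hom X X') (g : Hom Y Y')
    (h : Hom Z Z') (k : Hom W W') :
  exchange X' Y' Z' W' ∘ ((f ⊗ g) ⊗ (h ⊗ k))
  = ((f ⊗ h) ⊗ (g ⊗ k)) ∘ exchange X Y Z W.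
Proof.
  apply (iso_monic (assoc X' Z' (Y' ⊗ W')%ob)).
  rewrite !comp_assoc, exchange_swap_head, assoc_nat; assoc_r.
  rewrite assoc_nat, exchange_swap_head, !comp_assoc, <- !tensor_comp.
  rewrite swap_head_nat, comp_id_l, comp_id_r; reflexivity.
Qed.

(** Both sides permute [X X' Y Y' Z Z'] into [X Y Z X' Y' Z']. Once all is nested to the right, each
    is a composite of the same three adjacent swaps, of [X'] with [Y], [Y'] with [Z] and [X'] with
    [Z], and only the order of the first two differs. *)
Lemma exchange_assoc (X X' Y Y' Z Z' : C) :
  (assoc X Y Z ⊗ assoc X' Y' Z')
    ∘ exchange (X ⊗ Y)%ob (X' ⊗ Y')%ob Z Z'
    ∘ (exchange X X' Y Y' ⊗ id (Z ⊗ Z')%ob)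
  = exchange X X' (Y ⊗ Z)%ob (Y' ⊗ Z')%ob
    ∘ (id (X ⊗ X')%ob ⊗ exchange Y Y' Z Z')
    ∘ assoc (X ⊗ X')%ob (Y ⊗ Y')%ob (Z ⊗ Z')%ob.
Proof.
  apply (iso_monic (assoc X (Y ⊗ Z)%ob (X' ⊗ (Y' ⊗ Z'))%ob)).
  apply (iso_monic (iso_tensor (iso_id X) (assoc Y Z (X' ⊗ (Y' ⊗ Z'))%ob))).
  cbn; assoc_r.
  rewrite (whisker2 (exchange_swap_head X X' (Y ⊗ Z)%ob (Y' ⊗ Z')%ob)); assoc_r.
  rewrite (whisker2 (eq_sym (tensor_comp_id_l _ _ _))), swap_head_hexagon.
  rewrite <- (tensor_id X X'), (whisker2 (assoc_nat _ _ _)); assoc_r.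
  rewrite (whisker2 (eq_sym (tensor_comp_id_l _ _ _))); assoc_r.
  rewrite <- tensor_comp_id_l, exchange_swap_head, tensor_comp_id_l.
  rewrite (tensor_split_l (assoc X Y Z)); assoc_r.
  rewrite (whisker3 (eq_trans (comp_assoc _ _ _) (pentagon _ _ _ _))); assoc_r.
  rewrite <- (tensor_id (X ⊗ Y)%ob Z), (whisker2 (assoc_nat _ _ _)); assoc_r.
  rewrite (whisker2 (exchange_swap_head _ _ _ _)); assoc_r.
  rewrite (whisker2 (eq_sym (tensor_comp_id_l _ _ _))), swap_head_hexagon_l.
  rewrite <- (tensor_id X Y), (whisker2 (assoc_nat _ _ _)), !tensor_comp_id_l.
  assoc_r.
  rewrite (whisker2 (eq_sym (pentagon X Y (X' ⊗ Y')%ob (Z ⊗ Z')%ob))); assoc_r.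
  rewrite <- tensor_comp_id_r, exchange_swap_head, tensor_comp_id_r.
  rewrite (whisker2 (assoc_nat (id X) (swap_head X' Y Y') (id (Z ⊗ Z')%ob))).
  rewrite <- (pentagon X X' (Y ⊗ Y')%ob (Z ⊗ Z')%ob).
  rewrite !comp_assoc, <- !tensor_comp_id_l.
  do 2 f_equal; assoc_r; f_equal.
  (* The swaps of [X'] with [Y] and of [Y'] with [Z] act on disjoint factors, so they commute by
     naturality in the tail. *)
  rewrite (whisker2 (swap_head_nat (id X') (id Y) (swap_head Y' Z Z'))).
  rewrite !tensor_comp_id_l; assoc_r; do 2 f_equal.
  rewrite (comp_assoc (id Y ⊗ assoc _ _ _)); rewrite swap_head_tensor.
  assoc_r; reflexivity.
Qed.

Lemma exchange_runit (X Y : C) :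
  (runit X ⊗ runit Y) ∘ exchange X Y unit unit
  = runit (X ⊗ Y)%ob ∘ (id (X ⊗ Y)%ob ⊗ lunit unit).
Proof.
  rewrite tensor_split_r, <- triangle; assoc_r.
  rewrite exchange_swap_head, !comp_assoc, <- !tensor_comp_id_l; assoc_r.
  rewrite lunit_swap_head, <- runit_tensor, <- tensor_id; assoc_r.
  rewrite assoc_nat, comp_assoc, <- tensor_comp_id_l; reflexivity.
Qed.

Lemma exchange_lunit (X Y : C) :
  (lunit X ⊗ lunit Y) ∘ exchange unit unit X Y
  = lunit (X ⊗ Y)%ob ∘ (lunit unit ⊗ id (X ⊗ Y)%ob).
Proof.
  rewrite tensor_split_r, <- lunit_tensor; assoc_r.
  rewrite exchange_swap_head, (comp_assoc (id X ⊗ _)), <- lunit_nat; assoc_r.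
  rewrite (whisker2 (eq_sym (tensor_comp_id_l _ _ _))), swap_head_lunit.
  rewrite <- lunit_lunit, lunit_tensor; reflexivity.
Qed.

End Symmetric.

(** * Deterministic structure morphisms *)

Section Markov.
Context {C : MarkovCategory}.

Lemma deterministic_id (X : C) : deterministic (id X).
Proof. red; rewrite tensor_id, comp_id_l; apply comp_id_r. Qed.

Lemma deterministic_comp (X Y Z : C) (g : Hom Y Z) (f : Hom X Y) :
  deterministic g -> deterministic f -> deterministic (g ∘ f).
Proof.
  unfold deterministic; intros Hg Hf.
  rewrite comp_assoc, Hg, tensor_comp; assoc_r; rewrite Hf; reflexivity.
Qed.

Lemma deterministic_iso_inv (X Y : C) (i : Iso X Y) :
  deterministic i -> deterministic (iso_inv i).
Proof.
  unfold deterministic; intros Hi.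
  apply (iso_epic i); apply (iso_monic (iso_tensor i i)); cbn; assoc_r.
  rewrite iso_inv_hom, comp_id_r, <- Hi, Hi.
  rewrite comp_assoc, <- tensor_comp, iso_hom_inv, tensor_id, comp_id_l.
  reflexivity.
Qed.

Lemma deterministic_tensor (X X' Y Y' : C) (f : Hom X X') (g : Hom Y Y') :
  deterministic f -> deterministic g -> deterministic (f ⊗ g).
Proof.
  unfold deterministic; intros Hf Hg.
  rewrite !copy_tensor; assoc_r.
  rewrite <- tensor_comp, Hf, Hg, tensor_comp, !comp_assoc, exchange_nat.
  reflexivity.
Qed.

(* Counitality makes [del unit] split epi and [del_nat] makes it idempotent. *)
Lemma del_unit : del (unit : C) = id unit.
Proof.
  pose proof (copy_counit_l (unit : C)) as H.
  rewrite lunit_runit_unit, runit_nat in H; assoc_r.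
  rewrite <- (comp_id_r (del unit)), <- H at 1; assoc_r.
  rewrite (comp_assoc (del unit)), del_nat, comp_assoc; exact H.
Qed.

Lemma lunit_copy_unit : lunit unit ∘ copy (unit : C) = id unit.
Proof.
  rewrite <- (copy_counit_l (unit : C)), del_unit, tensor_id, comp_id_r.
  reflexivity.
Qed.

(** Unfolding the copies by [copy_tensor] leaves [exchange_assoc], combined with naturality of
    [assoc] at the three copy maps. *)
Lemma deterministic_assoc (X Y Z : C) : deterministic (assoc X Y Z).
Proof.
  red; rewrite !copy_tensor, tensor_comp_r, tensor_comp_l; assoc_r.
  rewrite <- assoc_nat, !comp_assoc, exchange_assoc; reflexivity.
Qed.

(** [exchange_lunit] leaves a factor [lunit unit ∘ copy unit], which is the identity. *)
Lemma deterministic_lunit (X : C) : deterministic (lunit X).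
Proof.
  red; rewrite copy_tensor, comp_assoc, exchange_lunit; assoc_r.
  rewrite <- tensor_comp, lunit_copy_unit, comp_id_l, lunit_nat.
  reflexivity.
Qed.

Lemma deterministic_runit (X : C) : deterministic (runit X).
Proof.
  red; rewrite copy_tensor, comp_assoc, exchange_runit; assoc_r.
  rewrite <- tensor_comp, lunit_copy_unit, comp_id_l, runit_nat.
  reflexivity.
Qed.

End Markov.

(** * Preservation of the exchange morphism by symmetric monoidal functors *)

Section MonoidalFunctor.
Context {C D : SymMonCategory} (F : SymMonFunctor C D).

Lemma smf_swap_head (X Y W : C) :
  fmap F (swap_head X Y W) ∘ smf_mu F X (Y ⊗ W)%ob ∘ (id (F X) ⊗ smf_mu F Y W)
  = smf_mu F Y (X ⊗ W)%ob ∘ (id (F Y) ⊗ smf_mu F X W)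
    ∘ swap_head (F X) (F Y) (F W).
Proof.
  apply (iso_epic (assoc (F X) (F Y) (F W))); assoc_r.
  rewrite swap_head_assoc, (comp_assoc (smf_mu F X _)), <- smf_assoc; assoc_r.
  rewrite (comp_assoc (fmap F (swap_head _ _ _))), <- fmap_comp, swap_head_assoc.
  rewrite fmap_comp; assoc_r.
  rewrite (whisker2 (eq_sym (smf_mu_nat F _ _))), fmap_id; assoc_r.
  rewrite <- tensor_comp_id_r, smf_swap, tensor_comp_id_r.
  rewrite (whisker3 (eq_trans (comp_assoc _ _ _) (smf_assoc F Y X W))).
  assoc_r; reflexivity.
Qed.

(** Applied to the evaluation functor, this compares the exchange of the transported category with
    that of [C]. *)
Lemma smf_exchange (X Y Z W : C) :
  fmap F (exchange X Y Z W) ∘ smf_mu F (X ⊗ Y)%ob (Z ⊗ W)%ob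
    ∘ (smf_mu F X Y ⊗ smf_mu F Z W)
  = smf_mu F (X ⊗ Z)%ob (Y ⊗ W)%ob ∘ (smf_mu F X Z ⊗ smf_mu F Y W)
    ∘ exchange (F X) (F Y) (F Z) (F W).
Proof.
  apply (iso_monic (iso_map F (assoc X Z (Y ⊗ W)%ob))); cbn; assoc_r.
  rewrite (comp_assoc (fmap F _)), <- fmap_comp, exchange_swap_head, fmap_comp.
  rewrite (tensor_split_l (smf_mu F X Y)), (tensor_split_l (smf_mu F X Z)).
  assoc_r.
  rewrite !(whisker3 (eq_trans (comp_assoc _ _ _) (smf_assoc F _ _ _))); assoc_r.
  rewrite <- !tensor_id, (whisker2 (assoc_nat _ _ _)); assoc_r.
  rewrite (assoc_nat (id (F X)) (id (F Y))), exchange_swap_head.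
  rewrite (whisker2 (eq_sym (smf_mu_nat F _ _))), fmap_id; assoc_r.
  rewrite !(whisker2 (eq_sym (tensor_comp_id_l _ _ _))), smf_swap_head.
  reflexivity.
Qed.

End MonoidalFunctor.

(** * Transport of structure to named objects *)

(* Unlike plain [cbn], this keeps the isomorphisms [om_assoc], [om_lunit] and
   [om_runit] defined below folded. *)
Ltac cbn_iso := cbn [iso_hom iso_inv iso_comp iso_tensor iso_id iso_sym].

(* A choice of names for some objects of [C], with a tensor product of names
   realizing that of [C] up to isomorphism; no law is imposed on the names. *)
Record object_model (C : MonoidalCategory) := {
  om_ob :> Type;
  om_ev : om_ob -> C;
  om_unit : om_ob;
  om_tensor : om_ob -> om_ob -> om_ob;
  om_mu : forall x y, Iso (om_ev x ⊗ om_ev y)%ob (om_ev (om_tensor x y));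
  om_eps : Iso unit (om_ev om_unit)
}.

Arguments om_ev {C} o x.
Arguments om_unit {C} o.
Arguments om_tensor {C o} x y.
Arguments om_mu {C o} x y.
Arguments om_eps {C o}.

(** * The transported monoidal structure *)

Section ModelMonoidal.
Context {C : MonoidalCategory} (M : object_model C).
Local Notation ev := (om_ev M).
Local Notation mu := (@om_mu C M).
Local Notation eps := (@om_eps C M).

(** The functor [ev] is fully faithful by construction, and the category laws are those of [C]. *)
Definition om_category : Category :=
  {| Ob := M; Hom := fun x y => Hom (ev x) (ev y);
     id := fun x => id (ev x); comp := fun x y z g f => g ∘ f;
     comp_id_l := fun x y f => comp_id_l f;
     comp_id_r := fun x y f => comp_id_r f;
     comp_assoc := fun w x y z h g f => comp_assoc h g f |}.

Definition om_iso (x y : M) (i : Iso (ev x) (ev y)) :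
  @Iso om_category x y :=
  @Build_Iso om_category x y i (iso_inv i) (iso_inv_hom i) (iso_hom_inv i).

Definition om_tensor_hom (x x' y y' : M) (f : Hom (ev x) (ev x'))
    (g : Hom (ev y) (ev y')) : Hom (ev (om_tensor x y)) (ev (om_tensor x' y')) :=
  mu x' y' ∘ (f ⊗ g) ∘ iso_inv (mu x y).

(** As the comparisons are invertible, this is the only choice satisfying the coherence square
    [om_assoc_mu] of a monoidal functor. The unitors arise in the same way from [om_lunit_mu] and
    [om_runit_mu]. *)
Definition om_assoc (x y z : M) :
  Iso (ev (om_tensor (om_tensor x y) z)) (ev (om_tensor x (om_tensor y z))) :=
  iso_comp (iso_comp (mu _ _) (iso_comp (iso_tensor (iso_id _) (mu _ _)) (assoc _ _ _)))
    (iso_sym (iso_comp (mu _ _) (iso_tensor (mu _ _) (iso_id _)))).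

Definition om_lunit (x : M) : Iso (ev (om_tensor (om_unit M) x)) (ev x) :=
  iso_comp (lunit _) (iso_sym (iso_comp (mu _ _) (iso_tensor eps (iso_id _)))).

Definition om_runit (x : M) : Iso (ev (om_tensor x (om_unit M))) (ev x) :=
  iso_comp (runit _) (iso_sym (iso_comp (mu _ _) (iso_tensor (iso_id _) eps))).

Lemma iso_sym_comp (X Y : C) (i : Iso X Y) : iso_sym i ∘ i = id X.
Proof. apply iso_inv_hom. Qed.

Lemma om_tensor_hom_mu (x x' y y' : M) (f : Hom (ev x) (ev x'))
    (g : Hom (ev y) (ev y')) :
  om_tensor_hom f g ∘ mu x y = mu x' y' ∘ (f ⊗ g).
Proof.
  unfold om_tensor_hom; assoc_r; rewrite iso_inv_hom, comp_id_r; reflexivity.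
Qed.

Lemma om_assoc_mu (x y z : M) :
  om_assoc x y z ∘ mu (om_tensor x y) z ∘ (mu x y ⊗ id (ev z))
  = mu x (om_tensor y z) ∘ (id (ev x) ⊗ mu y z) ∘ assoc (ev x) (ev y) (ev z).
Proof.
  unfold om_assoc; assoc_r.
  (* The two comparison maps are folded into a single isomorphism, whose inverse is the right factor
     of [om_assoc]; only the outermost composite is then opened, and the pair cancels at once. *)
  change (mu (om_tensor x y) z ∘ (mu x y ⊗ id (ev z))) with
    (iso_hom (iso_comp (mu (om_tensor x y) z) (iso_tensor (mu x y) (iso_id (ev z))))).
  change (iso_hom (iso_comp ?g ?f)) with (g ∘ f) at 1.
  assoc_r; rewrite iso_sym_comp; apply comp_id_r.
Qed.

Lemma om_lunit_mu (x : M) :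
  om_lunit x ∘ mu (om_unit M) x ∘ (eps ⊗ id (ev x)) = lunit (ev x).
Proof.
  assoc_r; unfold om_lunit.
  change (mu (om_unit M) x ∘ (eps ⊗ id (ev x))) with
    (iso_hom (iso_comp (mu (om_unit M) x) (iso_tensor eps (iso_id (ev x))))).
  change (iso_hom (iso_comp ?g ?f)) with (g ∘ f) at 1.
  assoc_r; rewrite iso_sym_comp; apply comp_id_r.
Qed.

Lemma om_runit_mu (x : M) :
  om_runit x ∘ mu x (om_unit M) ∘ (id (ev x) ⊗ eps) = runit (ev x).
Proof.
  assoc_r; unfold om_runit.
  change (mu x (om_unit M) ∘ (id (ev x) ⊗ eps)) with
    (iso_hom (iso_comp (mu x (om_unit M)) (iso_tensor (iso_id (ev x)) eps))).
  change (iso_hom (iso_comp ?g ?f)) with (g ∘ f) at 1.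
  assoc_r; rewrite iso_sym_comp; apply comp_id_r.
Qed.

Lemma om_tensor_hom_mu_l (x x' y y' : M) (Z Z' : C) (f : Hom (ev x) (ev x'))
    (g : Hom (ev y) (ev y')) (h : Hom Z Z') :
  (om_tensor_hom f g ⊗ h) ∘ (mu x y ⊗ id Z) = (mu x' y' ⊗ id Z') ∘ ((f ⊗ g) ⊗ h).
Proof.
  rewrite <- !tensor_comp, om_tensor_hom_mu, comp_id_l, comp_id_r; reflexivity.
Qed.

Lemma om_tensor_hom_mu_r (x x' y y' : M) (Z Z' : C) (f : Hom (ev x) (ev x'))
    (g : Hom (ev y) (ev y')) (h : Hom Z Z') :
  (h ⊗ om_tensor_hom f g) ∘ (id Z ⊗ mu x y) = (id Z' ⊗ mu x' y') ∘ (h ⊗ (f ⊗ g)).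
Proof.
  rewrite <- !tensor_comp, om_tensor_hom_mu, comp_id_l, comp_id_r; reflexivity.
Qed.

(** The pattern for the transported axioms: precompose with invertible comparisons, push these to
    the left through every structure map, and finish with the corresponding axiom of [C]. *)
Lemma om_tensor_id (x y : M) :
  om_tensor_hom (id (ev x)) (id (ev y)) = id (ev (om_tensor x y)).
Proof.
  apply (iso_epic (mu x y)).
  rewrite om_tensor_hom_mu, tensor_id, comp_id_l; apply comp_id_r.
Qed.

Lemma om_tensor_comp (x x' x'' y y' y'' : M)
    (f' : Hom (ev x') (ev x'')) (f : Hom (ev x) (ev x'))
    (g' : Hom (ev y') (ev y'')) (g : Hom (ev y) (ev y')) :
  om_tensor_hom (f' ∘ f) (g' ∘ g) = om_tensor_hom f' g' ∘ om_tensor_hom f g.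
Proof.
  apply (iso_epic (mu x y)); assoc_r.
  rewrite !om_tensor_hom_mu, comp_assoc, om_tensor_hom_mu, tensor_comp.
  apply comp_assoc.
Qed.

Lemma om_assoc_nat (x x' y y' z z' : M) (f : Hom (ev x) (ev x'))
    (g : Hom (ev y) (ev y')) (h : Hom (ev z) (ev z')) :
  om_assoc x' y' z' ∘ om_tensor_hom (om_tensor_hom f g) h
  = om_tensor_hom f (om_tensor_hom g h) ∘ om_assoc x y z.
Proof.
  apply (iso_epic (iso_comp (mu _ z) (iso_tensor (mu x y) (iso_id _)))); cbn_iso; assoc_r.
  rewrite (whisker2 (om_tensor_hom_mu _ _)); assoc_r.
  rewrite om_tensor_hom_mu_l.
  rewrite !(whisker3 (eq_trans (comp_assoc _ _ _) (om_assoc_mu _ _ _))).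
  rewrite (comp_assoc (om_assoc x y z)), om_assoc_mu; assoc_r.
  rewrite (whisker2 (om_tensor_hom_mu _ _)); assoc_r.
  rewrite (whisker2 (om_tensor_hom_mu_r _ _ _)); assoc_r.
  rewrite assoc_nat; reflexivity.
Qed.

Lemma om_lunit_nat (x x' : M) (f : Hom (ev x) (ev x')) :
  om_lunit x' ∘ om_tensor_hom (id (ev (om_unit M))) f = f ∘ om_lunit x.
Proof.
  apply (iso_epic (iso_comp (mu _ x) (iso_tensor eps (iso_id _)))); cbn_iso; assoc_r.
  rewrite (whisker2 (om_tensor_hom_mu _ _)); assoc_r.
  rewrite (comp_assoc (om_lunit x)), om_lunit_mu, <- lunit_nat, <- om_lunit_mu.
  assoc_r; rewrite <- !tensor_comp, !comp_id_l, !comp_id_r; reflexivity.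
Qed.

Lemma om_runit_nat (x x' : M) (f : Hom (ev x) (ev x')) :
  om_runit x' ∘ om_tensor_hom f (id (ev (om_unit M))) = f ∘ om_runit x.
Proof.
  apply (iso_epic (iso_comp (mu x _) (iso_tensor (iso_id _) eps))); cbn_iso; assoc_r.
  rewrite (whisker2 (om_tensor_hom_mu _ _)); assoc_r.
  rewrite (comp_assoc (om_runit x)), om_runit_mu, <- runit_nat, <- om_runit_mu.
  assoc_r; rewrite <- !tensor_comp, !comp_id_l, !comp_id_r; reflexivity.
Qed.

Lemma om_pentagon (w x y z : M) :
  om_tensor_hom (id (ev w)) (om_assoc x y z) ∘ om_assoc w (om_tensor x y) z
    ∘ om_tensor_hom (om_assoc w x y) (id (ev z))
  = om_assoc w x (om_tensor y z) ∘ om_assoc (om_tensor w x) y z.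
Proof.
  apply (iso_epic (iso_comp (mu _ z) (iso_tensor
    (iso_comp (mu _ y) (iso_tensor (mu w x) (iso_id _))) (iso_id _)))).
  cbn_iso; assoc_r.
  rewrite (whisker2 (om_tensor_hom_mu _ _)); assoc_r.
  rewrite <- tensor_comp_id_r, (comp_assoc (om_assoc w x y)), om_assoc_mu.
  rewrite !tensor_comp_id_r; assoc_r.
  rewrite !(whisker3 (eq_trans (comp_assoc _ _ _) (om_assoc_mu _ _ _))); assoc_r.
  rewrite (whisker2 (om_tensor_hom_mu _ _)); assoc_r.
  rewrite (whisker2 (assoc_nat _ _ _)); assoc_r.
  rewrite !(whisker2 (eq_sym (tensor_comp_id_l _ _ _))), om_assoc_mu.
  rewrite !tensor_comp_id_l; assoc_r.
  rewrite (comp_assoc (id _ ⊗ assoc _ _ _)), pentagon.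
  rewrite assoc_nat, tensor_id, (whisker2 (eq_sym (tensor_split_r _ _))).
  rewrite (tensor_split_l (mu w x)); assoc_r.
  rewrite (whisker3 (eq_trans (comp_assoc _ _ _) (om_assoc_mu _ _ _))); assoc_r.
  rewrite <- (tensor_id (ev w) (ev x)), (whisker2 (assoc_nat _ _ _)); assoc_r.
  reflexivity.
Qed.

Lemma om_triangle (x y : M) :
  om_tensor_hom (id (ev x)) (om_lunit y) ∘ om_assoc x (om_unit M) y
  = om_tensor_hom (om_runit x) (id (ev y)).
Proof.
  apply (iso_epic (iso_comp (mu _ y) (iso_tensor
    (iso_comp (mu x _) (iso_tensor (iso_id _) eps)) (iso_id _)))).
  cbn_iso; assoc_r.
  rewrite (whisker2 (om_tensor_hom_mu _ _)); assoc_r.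
  rewrite <- tensor_comp_id_r, (comp_assoc (om_runit x)), om_runit_mu.
  rewrite tensor_comp_id_r.
  rewrite (whisker3 (eq_trans (comp_assoc _ _ _) (om_assoc_mu _ _ _))); assoc_r.
  rewrite (whisker2 (om_tensor_hom_mu _ _)); assoc_r.
  rewrite assoc_nat, !(whisker2 (eq_sym (tensor_comp_id_l _ _ _))).
  rewrite om_lunit_mu, triangle; reflexivity.
Qed.


Definition om_monoidal : MonoidalCategory :=
  {| mon_cat := om_category; unit := om_unit M; tensor := om_tensor;
     tensor_hom := om_tensor_hom; tensor_id := om_tensor_id;
     tensor_comp := om_tensor_comp;
     assoc := fun x y z => om_iso (om_assoc x y z);
     lunit := fun x => om_iso (om_lunit x); runit := fun x => om_iso (om_runit x);
     assoc_nat := om_assoc_nat; lunit_nat := om_lunit_nat;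
     runit_nat := om_runit_nat; pentagon := om_pentagon;
     triangle := om_triangle |}.

End ModelMonoidal.

Arguments om_iso {C M x y} i.

(** * The transported symmetry and the evaluation functor *)

Section ModelSymmetric.
Context {C : SymMonCategory} (M : object_model C).
Local Notation ev := (om_ev M).
Local Notation mu := (@om_mu C M).

Definition om_swap (x y : M) : Hom (ev (om_tensor x y)) (ev (om_tensor y x)) :=
  mu y x ∘ swap (ev x) (ev y) ∘ iso_inv (mu x y).

Lemma om_swap_mu (x y : M) : om_swap x y ∘ mu x y = mu y x ∘ swap (ev x) (ev y).
Proof.
  unfold om_swap; assoc_r; rewrite iso_inv_hom, comp_id_r; reflexivity.
Qed.

Lemma om_swap_nat (x x' y y' : M) (f : Hom (ev x) (ev x')) (g : Hom (ev y) (ev y')) :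
  om_swap x' y' ∘ om_tensor_hom f g = om_tensor_hom g f ∘ om_swap x y.
Proof.
  apply (iso_epic (mu x y)); assoc_r.
  rewrite om_tensor_hom_mu, om_swap_mu, !comp_assoc, om_swap_mu, om_tensor_hom_mu.
  assoc_r; rewrite swap_nat; reflexivity.
Qed.

Lemma om_swap_swap (x y : M) : om_swap y x ∘ om_swap x y = id (ev (om_tensor x y)).
Proof.
  apply (iso_epic (mu x y)); assoc_r.
  rewrite om_swap_mu, comp_assoc, om_swap_mu; assoc_r.
  rewrite swap_swap, comp_id_l; apply comp_id_r.
Qed.

Lemma om_hexagon (x y z : M) :
  om_assoc y z x ∘ om_swap x (om_tensor y z) ∘ om_assoc x y z
  = om_tensor_hom (id (ev y)) (om_swap x z) ∘ om_assoc y x z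
    ∘ om_tensor_hom (om_swap x y) (id (ev z)).
Proof.
  apply (iso_epic (iso_comp (mu _ z) (iso_tensor (mu x y) (iso_id _)))).
  cbn_iso; assoc_r.
  rewrite (comp_assoc (om_assoc x y z)), om_assoc_mu; assoc_r.
  rewrite (whisker2 (om_swap_mu _ _)); assoc_r.
  rewrite (whisker2 (swap_nat _ _)); assoc_r.
  rewrite (whisker3 (eq_trans (comp_assoc _ _ _) (om_assoc_mu _ _ _))); assoc_r.
  rewrite (comp_assoc (assoc _ _ _)), hexagon.
  rewrite (whisker2 (om_tensor_hom_mu _ _)); assoc_r.
  rewrite <- tensor_comp_id_r, om_swap_mu, tensor_comp_id_r.
  rewrite (whisker3 (eq_trans (comp_assoc _ _ _) (om_assoc_mu _ _ _))); assoc_r.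
  rewrite (whisker2 (om_tensor_hom_mu _ _)); assoc_r.
  rewrite !(whisker2 (eq_sym (tensor_comp_id_l _ _ _))), om_swap_mu; reflexivity.
Qed.

Definition om_symmetric : SymMonCategory :=
  {| sym_mon := om_monoidal M; swap := om_swap; swap_nat := om_swap_nat;
     swap_swap := om_swap_swap; hexagon := om_hexagon |}.

Definition om_functor : Functor om_symmetric C :=
  @Build_Functor om_symmetric C ev (fun _ _ f => f)
    (fun _ => eq_refl) (fun _ _ _ _ _ => eq_refl).

Lemma om_mu_nat (x x' y y' : M) (f : Hom (ev x) (ev x')) (g : Hom (ev y) (ev y')) :
  mu x' y' ∘ (f ⊗ g) = om_tensor_hom f g ∘ mu x y.
Proof. symmetry; apply om_tensor_hom_mu. Qed.

(** The coherence conditions are the equations characterising the transported associators, unitors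
    and swap. *)
Definition om_sym_functor : SymMonFunctor om_symmetric C :=
  @Build_SymMonFunctor om_symmetric C om_functor mu om_eps om_mu_nat
    (om_assoc_mu (M := M)) (om_lunit_mu (M := M)) (om_runit_mu (M := M)) om_swap_mu.

End ModelSymmetric.

(** * The transported comonoids *)

Section ModelMarkov.
Context {C : MarkovCategory} (M : object_model C).
Local Notation ev := (om_ev M).
Local Notation mu := (@om_mu C M).
Local Notation eps := (@om_eps C M).
Context (mu_det : forall x y : M, deterministic (mu x y)).

Definition om_copy (x : M) : Hom (ev x) (ev (om_tensor x x)) := mu x x ∘ copy (ev x).

Definition om_del (x : M) : Hom (ev x) (ev (om_unit M)) := eps ∘ del (ev x).

(** Typed as a morphism of [C], so that the laws of [C] can be rewritten around it. *)
Definition om_exchange (x y z w : M) :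
    Hom (ev (om_tensor (om_tensor x y) (om_tensor z w)))
      (ev (om_tensor (om_tensor x z) (om_tensor y w))) :=
  @exchange (om_symmetric M) x y z w.

Lemma om_exchange_mu (x y z w : M) :
  om_exchange x y z w ∘ mu _ _ ∘ (mu x y ⊗ mu z w)
  = mu _ _ ∘ (mu x z ⊗ mu y w) ∘ exchange (ev x) (ev y) (ev z) (ev w).
Proof. exact (smf_exchange (om_sym_functor M) x y z w). Qed.

Lemma om_copy_coassoc (x : M) :
  om_assoc x x x ∘ om_tensor_hom (om_copy x) (id (ev x)) ∘ om_copy x
  = om_tensor_hom (id (ev x)) (om_copy x) ∘ om_copy x.
Proof.
  unfold om_copy; assoc_r.
  rewrite !(whisker2 (om_tensor_hom_mu _ _)), tensor_comp_id_r; assoc_r.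
  rewrite (whisker3 (eq_trans (comp_assoc _ _ _) (om_assoc_mu _ _ _))); assoc_r.
  rewrite (comp_assoc (assoc _ _ _)), copy_coassoc, tensor_comp_id_l; assoc_r.
  reflexivity.
Qed.

Lemma om_copy_counit_l (x : M) :
  om_lunit x ∘ om_tensor_hom (om_del x) (id (ev x)) ∘ om_copy x = id (ev x).
Proof.
  unfold om_copy, om_del; assoc_r.
  rewrite (whisker2 (om_tensor_hom_mu _ _)), tensor_comp_id_r; assoc_r.
  rewrite (whisker3 (eq_trans (comp_assoc _ _ _) (om_lunit_mu _))), comp_assoc.
  apply copy_counit_l.
Qed.

Lemma om_copy_counit_r (x : M) :
  om_runit x ∘ om_tensor_hom (id (ev x)) (om_del x) ∘ om_copy x = id (ev x).
Proof.
  unfold om_copy, om_del; assoc_r.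
  rewrite (whisker2 (om_tensor_hom_mu _ _)), tensor_comp_id_l; assoc_r.
  rewrite (whisker3 (eq_trans (comp_assoc _ _ _) (om_runit_mu _))), comp_assoc.
  apply copy_counit_r.
Qed.

Lemma om_copy_cocomm (x : M) : om_swap x x ∘ om_copy x = om_copy x.
Proof.
  unfold om_copy; rewrite comp_assoc, om_swap_mu; assoc_r.
  rewrite copy_cocomm; reflexivity.
Qed.

Lemma om_del_tensor (x y : M) :
  om_del (om_tensor x y)
  = om_lunit (om_unit M) ∘ om_tensor_hom (om_del x) (om_del y).
Proof.
  apply (iso_epic (mu x y)); unfold om_del; assoc_r.
  rewrite del_nat, om_tensor_hom_mu, tensor_comp_l.
  rewrite (whisker3 (eq_trans (comp_assoc _ _ _) (om_lunit_mu _))).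
  rewrite tensor_comp_r, (whisker2 (lunit_nat _)); assoc_r.
  rewrite <- del_tensor; reflexivity.
Qed.

(** Determinism of [mu] lets [copy] slide past [mu x y]; what remains is [copy_tensor] in [C] and
    the comparison of the two exchanges. *)
Lemma om_copy_tensor (x y : M) :
  om_copy (om_tensor x y)
  = om_exchange x x y y ∘ om_tensor_hom (om_copy x) (om_copy y).
Proof.
  apply (iso_epic (mu x y)); unfold om_copy; assoc_r.
  rewrite mu_det, om_tensor_hom_mu, tensor_comp.
  rewrite (whisker3 (eq_trans (comp_assoc _ _ _) (om_exchange_mu _ _ _ _))).
  rewrite copy_tensor; assoc_r; reflexivity.
Qed.

Lemma om_del_nat (x y : M) (f : Hom (ev x) (ev y)) : om_del y ∘ f = om_del x.
Proof. unfold om_del; assoc_r; rewrite del_nat; reflexivity. Qed.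

Definition om_markov : MarkovCategory :=
  {| markov_sym := om_symmetric M; copy := om_copy; del := om_del;
     copy_coassoc := om_copy_coassoc; copy_counit_l := om_copy_counit_l;
     copy_counit_r := om_copy_counit_r; copy_cocomm := om_copy_cocomm;
     del_tensor := om_del_tensor; copy_tensor := om_copy_tensor;
     del_nat := om_del_nat |}.

Definition om_markov_functor : MarkovFunctor om_markov C :=
  @Build_MarkovFunctor om_markov C (om_sym_functor M) (fun x => eq_refl).

Lemma om_deterministic (x y : M) (f : Hom (ev x) (ev y)) :
  deterministic f -> @deterministic om_markov x y f.
Proof.
  intros Hf.
  change (om_copy y ∘ f = om_tensor_hom f f ∘ om_copy x).
  unfold om_copy; rewrite (comp_assoc (om_tensor_hom f f)), om_tensor_hom_mu.
  assoc_r; rewrite Hf; reflexivity.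
Qed.

(** * The quasi-inverse of evaluation *)

Context (sec : C -> M) (r : forall X : C, Iso (ev (sec X)) X).
Context (r_det : forall X : C, deterministic (r X)).

Definition om_sec_hom (X Y : C) (f : Hom X Y) : Hom (ev (sec X)) (ev (sec Y)) :=
  iso_inv (r Y) ∘ f ∘ r X.

(** The comparison forced by asking [r] to be a monoidal transformation; [om_sec_mu_r] is that
    condition. *)
Definition om_sec_mu (X Y : C) :
    Iso (ev (om_tensor (sec X) (sec Y))) (ev (sec (X ⊗ Y)%ob)) :=
  iso_comp (iso_sym (r _)) (iso_comp (iso_tensor (r X) (r Y)) (iso_sym (mu _ _))).

Definition om_sec_eps : Iso (ev (om_unit M)) (ev (sec unit)) :=
  iso_comp (iso_sym (r unit)) (iso_sym eps).

Lemma om_sec_hom_r (X Y : C) (f : Hom X Y) : r Y ∘ om_sec_hom f = f ∘ r X.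
Proof. unfold om_sec_hom; assoc_r; apply iso_hom_cancel. Qed.

Lemma om_sec_mu_r (X Y : C) : r _ ∘ om_sec_mu X Y ∘ mu _ _ = r X ⊗ r Y.
Proof.
  unfold om_sec_mu; cbn_iso; assoc_r.
  rewrite iso_hom_cancel, iso_inv_hom; apply comp_id_r.
Qed.

Lemma om_sec_eps_r : r unit ∘ om_sec_eps ∘ eps = id unit.
Proof.
  unfold om_sec_eps; cbn_iso; assoc_r.
  rewrite iso_hom_cancel; apply iso_inv_hom.
Qed.

Lemma om_sec_hom_id (X : C) : om_sec_hom (id X) = id (ev (sec X)).
Proof.
  apply (iso_monic (r X)); rewrite om_sec_hom_r, comp_id_l, comp_id_r.
  reflexivity.
Qed.

Lemma om_sec_hom_comp (X Y Z : C) (g : Hom Y Z) (f : Hom X Y) :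
  om_sec_hom (g ∘ f) = om_sec_hom g ∘ om_sec_hom f.
Proof.
  apply (iso_monic (r Z)).
  rewrite om_sec_hom_r, comp_assoc, om_sec_hom_r; assoc_r.
  rewrite om_sec_hom_r; reflexivity.
Qed.

Lemma om_sec_mu_nat (X X' Y Y' : C) (f : Hom X X') (g : Hom Y Y') :
  om_sec_mu X' Y' ∘ om_tensor_hom (om_sec_hom f) (om_sec_hom g)
  = om_sec_hom (f ⊗ g) ∘ om_sec_mu X Y.
Proof.
  apply (iso_monic (r _)), (iso_epic (mu _ _)); assoc_r.
  rewrite om_tensor_hom_mu, (whisker2 (om_sec_hom_r _)); assoc_r.
  rewrite !(comp_assoc (om_sec_mu _ _)), !(comp_assoc (r _)).
  rewrite !om_sec_mu_r, <- !tensor_comp.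
  rewrite !om_sec_hom_r; reflexivity.
Qed.

Lemma om_sec_assoc (X Y Z : C) :
  om_sec_hom (assoc X Y Z) ∘ om_sec_mu (X ⊗ Y)%ob Z
    ∘ om_tensor_hom (om_sec_mu X Y) (id (ev (sec Z)))
  = om_sec_mu X (Y ⊗ Z)%ob ∘ om_tensor_hom (id (ev (sec X))) (om_sec_mu Y Z)
    ∘ om_assoc (sec X) (sec Y) (sec Z).
Proof.
  apply (iso_monic (r _)).
  apply (iso_epic (iso_comp (mu _ _) (iso_tensor (mu (sec X) (sec Y)) (iso_id _)))).
  cbn_iso; assoc_r.
  rewrite !(whisker2 (om_tensor_hom_mu _ _)); assoc_r.
  rewrite (comp_assoc (om_assoc _ _ _)), om_assoc_mu; assoc_r.
  rewrite (whisker2 (om_tensor_hom_mu _ _)); assoc_r.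
  rewrite (whisker2 (om_sec_hom_r _)); assoc_r.
  rewrite !(whisker3 (eq_trans (comp_assoc _ _ _) (om_sec_mu_r _ _))).
  rewrite !(whisker2 (eq_sym (tensor_comp _ _ _ _))).
  rewrite <- !tensor_comp, !om_sec_mu_r, !comp_id_r; apply assoc_nat.
Qed.

Lemma om_sec_lunit (X : C) :
  om_sec_hom (lunit X) ∘ om_sec_mu unit X
    ∘ om_tensor_hom om_sec_eps (id (ev (sec X)))
  = om_lunit (sec X).
Proof.
  apply (iso_monic (r _)).
  apply (iso_epic (iso_comp (mu _ _) (iso_tensor eps (iso_id _)))).
  cbn_iso; assoc_r.
  rewrite (whisker2 (om_tensor_hom_mu _ _)); assoc_r.
  rewrite (comp_assoc (om_lunit _)), om_lunit_mu, (whisker2 (om_sec_hom_r _)); assoc_r.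
  rewrite (whisker3 (eq_trans (comp_assoc _ _ _) (om_sec_mu_r _ _))).
  rewrite <- !tensor_comp, comp_assoc, om_sec_eps_r, !comp_id_r.
  apply lunit_nat.
Qed.

Lemma om_sec_runit (X : C) :
  om_sec_hom (runit X) ∘ om_sec_mu X unit
    ∘ om_tensor_hom (id (ev (sec X))) om_sec_eps
  = om_runit (sec X).
Proof.
  apply (iso_monic (r _)).
  apply (iso_epic (iso_comp (mu _ _) (iso_tensor (iso_id _) eps))).
  cbn_iso; assoc_r.
  rewrite (whisker2 (om_tensor_hom_mu _ _)); assoc_r.
  rewrite (comp_assoc (om_runit _)), om_runit_mu, (whisker2 (om_sec_hom_r _)); assoc_r.
  rewrite (whisker3 (eq_trans (comp_assoc _ _ _) (om_sec_mu_r _ _))).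
  rewrite <- !tensor_comp, (comp_assoc (r unit)), om_sec_eps_r, !comp_id_r.
  apply runit_nat.
Qed.

Lemma om_sec_swap (X Y : C) :
  om_sec_hom (swap X Y) ∘ om_sec_mu X Y
  = om_sec_mu Y X ∘ om_swap (sec X) (sec Y).
Proof.
  apply (iso_monic (r _)), (iso_epic (mu _ _)); assoc_r.
  rewrite om_swap_mu, (whisker2 (om_sec_hom_r _)); assoc_r.
  rewrite (whisker3 (eq_trans (comp_assoc _ _ _) (om_sec_mu_r _ _))).
  rewrite (comp_assoc (r _)), om_sec_mu_r; apply swap_nat.
Qed.

Definition om_sec_functor : Functor C om_markov :=
  @Build_Functor C om_markov sec om_sec_hom om_sec_hom_id om_sec_hom_comp.

Definition om_sec_sym_functor : SymMonFunctor C om_markov :=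
  @Build_SymMonFunctor C om_markov om_sec_functor
    (fun X Y => om_iso (om_sec_mu X Y)) (om_iso om_sec_eps)
    om_sec_mu_nat om_sec_assoc om_sec_lunit om_sec_runit om_sec_swap.

(** After cancelling [r], this is exactly determinism of [r X]. *)
Lemma om_sec_copy (X : C) :
  om_sec_mu X X ∘ om_copy (sec X) = om_sec_hom (copy X).
Proof.
  apply (iso_monic (r _)); unfold om_copy.
  rewrite (whisker3 (eq_trans (comp_assoc _ _ _) (om_sec_mu_r _ _))).
  rewrite om_sec_hom_r; symmetry; apply r_det.
Qed.

Definition om_sec_markov_functor : MarkovFunctor C om_markov :=
  @Build_MarkovFunctor C om_markov om_sec_sym_functor om_sec_copy.

Lemma om_counit_tensor (x y : M) :
  r (ev (om_tensor x y))
    ∘ (om_sec_hom (mu x y) ∘ om_sec_mu (ev x) (ev y))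
  = id (ev (om_tensor x y)) ∘ om_tensor_hom (r (ev x)) (r (ev y)).
Proof.
  apply (iso_epic (mu _ _)); assoc_r.
  rewrite om_tensor_hom_mu, (whisker2 (om_sec_hom_r _)), comp_id_l; assoc_r.
  rewrite (comp_assoc (r _)), om_sec_mu_r; reflexivity.
Qed.

Lemma om_counit_unit :
  r (ev (om_unit M)) ∘ (om_sec_hom eps ∘ om_sec_eps) = id (ev (om_unit M)).
Proof.
  apply (iso_epic eps); assoc_r.
  rewrite (whisker2 (om_sec_hom_r _)), comp_id_l; assoc_r.
  rewrite (comp_assoc (r _)), om_sec_eps_r; apply comp_id_r.
Qed.

Definition om_counit :
    MarkovTrans (mf_comp om_sec_markov_functor om_markov_functor) (mf_id om_markov) :=
  let FG := mf_comp om_sec_markov_functor om_markov_functor in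
  @Build_MarkovTrans om_markov om_markov FG (mf_id om_markov)
    (@Build_MonTrans om_markov om_markov FG (mf_id om_markov)
      (fun x : M => iso_hom (r (ev x))) (fun x y f => om_sec_hom_r f)
      om_counit_tensor om_counit_unit)
    (fun x => om_deterministic (r_det (ev x))).

Lemma om_unit_inv_tensor (X Y : C) :
  r (X ⊗ Y)%ob ∘ (om_sec_mu X Y ∘ mu (sec X) (sec Y))
  = id (X ⊗ Y)%ob ∘ (r X ⊗ r Y).
Proof. rewrite comp_id_l, comp_assoc; apply om_sec_mu_r. Qed.

Lemma om_unit_inv_unit : r unit ∘ (om_sec_eps ∘ eps) = id unit.
Proof. rewrite comp_assoc; exact om_sec_eps_r. Qed.

(** Built from the composite to the identity, since [r] points that way; its inverse is the unit of
    the equivalence. *)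
Definition om_unit_inv :
    MarkovTrans (mf_comp om_markov_functor om_sec_markov_functor) (mf_id C) :=
  let GF := mf_comp om_markov_functor om_sec_markov_functor in
  @Build_MarkovTrans C C GF (mf_id C)
    (@Build_MonTrans C C GF (mf_id C) (fun X : C => iso_hom (r X))
      (fun X Y f => om_sec_hom_r f) om_unit_inv_tensor om_unit_inv_unit)
    r_det.

End ModelMarkov.

(** * Invertible 2-cells *)

Section Transformations.
Context {C D : MarkovCategory}.

(** All fields other than the components are propositions, so function extensionality and proof
    irrelevance suffice. *)
Lemma MarkovTrans_ext (F G : MarkovFunctor C D) (a b : MarkovTrans F G) :
  (forall X, a X = b X) -> a = b.
Proof.
  destruct a as [[a a1 a2 a3] a4], b as [[b b1 b2 b3] b4]; cbn; intros H.
  assert (E : a = b) by (apply functional_extensionality_dep; exact H).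
  subst b.
  destruct (proof_irrelevance _ a1 b1), (proof_irrelevance _ a2 b2).
  destruct (proof_irrelevance _ a3 b3), (proof_irrelevance _ a4 b4); reflexivity.
Qed.

Lemma isomorphic_1mor_sym (F G : MarkovFunctor C D) :
  isomorphic_1mor F G -> isomorphic_1mor G F.
Proof. intros (a & b & Hba & Hab); exists b, a; split; assumption. Qed.

(** Componentwise inverses are automatically natural, monoidal and deterministic: each condition is
    that of [a] conjugated by isomorphisms. *)
Lemma isomorphic_1mor_of_iso (F G : MarkovFunctor C D) (a : MarkovTrans F G)
    (i : forall X : C, Iso (F X) (G X)) (Hi : forall X, iso_hom (i X) = a X) :
  isomorphic_1mor F G.
Proof.
  assert (Hnat : forall (X Y : C) (f : Hom X Y),
      iso_inv (i Y) ∘ fmap G f = fmap F f ∘ iso_inv (i X)).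
  { intros X Y f; apply (iso_monic (i Y)), (iso_epic (i X)); assoc_r.
    rewrite iso_hom_cancel, iso_inv_hom, comp_id_r, !Hi.
    symmetry; apply mt_nat. }
  assert (Htensor : forall X Y : C,
      iso_inv (i (X ⊗ Y)%ob) ∘ smf_mu G X Y
      = smf_mu F X Y ∘ (iso_inv (i X) ⊗ iso_inv (i Y))).
  { intros X Y; apply (iso_monic (i _)), (iso_epic (iso_tensor (i X) (i Y))).
    cbn_iso; assoc_r.
    rewrite iso_hom_cancel, <- tensor_comp, !iso_inv_hom, tensor_id, comp_id_r, !Hi.
    symmetry; apply mt_tensor. }
  assert (Hunit : iso_inv (i unit) ∘ smf_eps G = smf_eps F).
  { apply (iso_monic (i unit)); rewrite iso_hom_cancel, Hi.
    symmetry; apply mt_unit. }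
  assert (Hdet : forall X : C, deterministic (iso_inv (i X))).
  { intros X; apply deterministic_iso_inv; rewrite Hi; apply mkt_det. }
  exists a, {| mkt_trans := {| mt_app := fun X => iso_inv (i X); mt_nat := Hnat;
    mt_tensor := Htensor; mt_unit := Hunit |}; mkt_det := Hdet |}.
  split; apply MarkovTrans_ext; intros X; cbn; rewrite <- Hi.
  - apply iso_inv_hom.
  - apply iso_hom_inv.
Qed.

End Transformations.

Lemma om_comonoid_equivalent (C : MarkovCategory) (M : object_model C)
    (mu_det : forall x y : M, deterministic (om_mu x y))
    (sec : C -> M) (r : forall X : C, Iso (om_ev M (sec X)) X)
    (r_det : forall X : C, deterministic (r X)) :
  comonoid_equivalent C (om_markov mu_det).
Proof.
  exists (om_sec_markov_functor mu_det r_det), (om_markov_functor mu_det); split.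
  - apply isomorphic_1mor_sym.
    apply (isomorphic_1mor_of_iso (a := om_unit_inv mu_det r_det) (i := r)).
    reflexivity.
  - apply (isomorphic_1mor_of_iso (a := om_counit mu_det r_det)
      (i := fun x : M => om_iso (r (om_ev M x)))).
    reflexivity.
Qed.

(** * Words *)

Section Words.
Local Open Scope list_scope.
Context {C : MarkovCategory}.

(** Every word ends in a trailing [unit], so a one-letter word evaluates to [X ⊗ unit] and
    inductions have a single nonempty case. *)
Fixpoint word_ev (l : list C) : C :=
  match l with nil => unit | X :: l' => (X ⊗ word_ev l')%ob end.

Fixpoint word_mu (l m : list C) : Iso (word_ev l ⊗ word_ev m)%ob (word_ev (l ++ m)) :=
  match l with
  | nil => lunit (word_ev m)
  | X :: l' => iso_comp (iso_tensor (iso_id X) (word_mu l' m))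
      (assoc X (word_ev l') (word_ev m))
  end.

Definition word_model : object_model C :=
  {| om_ob := list C; om_ev := word_ev; om_unit := nil; om_tensor := @app C;
     om_mu := word_mu; om_eps := iso_id unit |}.

Lemma word_mu_deterministic (l m : list C) : deterministic (word_mu l m).
Proof.
  induction l as [|X l IH]; cbn.
  - apply deterministic_lunit.
  - apply deterministic_comp; [|apply deterministic_assoc].
    apply deterministic_tensor; [apply deterministic_id|exact IH].
Qed.

Definition word_cast (l m : list C) (e : l = m) : Hom (word_ev l) (word_ev m) :=
  @eq_to_hom (om_category word_model) l m e.

Lemma word_cast_cons (X : C) (l m : list C) (e : l = m) :
  word_cast (f_equal (cons X) e) = id X ⊗ word_cast e.
Proof. destruct e; symmetry; apply tensor_id. Qed.

(** The equality is built along the induction: in the nonempty case it is [f_equal (cons X) e],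
    whose cast is [id X ⊗ word_cast e]. The base case is [lunit_tensor], the step is [pentagon]. *)
Lemma word_mu_assoc (l m n : list C) :
  exists e : (l ++ m) ++ n = l ++ m ++ n,
    word_cast e ∘ word_mu (l ++ m) n ∘ (word_mu l m ⊗ id (word_ev n))
    = word_mu l (m ++ n) ∘ (id (word_ev l) ⊗ word_mu m n)
      ∘ assoc (word_ev l) (word_ev m) (word_ev n).
Proof.
  induction l as [|X l [e IH]].
  - exists eq_refl; cbn.
    rewrite lunit_nat; assoc_r; rewrite lunit_tensor, comp_id_l; reflexivity.
  - exists (f_equal (cons X) e); cbn -[word_cast]; rewrite word_cast_cons; assoc_r.
    rewrite tensor_comp_id_r; assoc_r.
    rewrite (whisker2 (assoc_nat _ _ _)); assoc_r.
    rewrite !(whisker2 (eq_sym (tensor_comp_id_l _ _ _))); assoc_r.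
    rewrite (comp_assoc (word_cast e)), IH, !tensor_comp_id_l; assoc_r.
    rewrite (comp_assoc (id X ⊗ assoc _ _ _)), pentagon.
    rewrite <- (tensor_id X), (whisker2 (assoc_nat _ _ _)); assoc_r.
    reflexivity.
Qed.

Lemma word_mu_runit (l : list C) :
  exists e : l ++ nil = l,
    word_cast e ∘ word_mu l nil = runit (word_ev l).
Proof.
  induction l as [|X l [e IH]].
  - exists eq_refl; cbn; rewrite comp_id_l; apply lunit_runit_unit.
  - exists (f_equal (cons X) e); cbn -[word_cast] in *; rewrite word_cast_cons.
    rewrite comp_assoc, <- tensor_comp_id_l, IH; apply runit_tensor.
Qed.

(** A transported structure isomorphism and the cast agree after precomposition with the same
    invertible comparisons, hence are equal. *)
Lemma word_strict : strict_monoidal (om_monoidal word_model).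
Proof.
  split; [|split].
  - intros l m n; destruct (word_mu_assoc l m n) as [e He]; exists e.
    apply (iso_epic (iso_comp (word_mu (l ++ m) n)
      (iso_tensor (word_mu l m) (iso_id (word_ev n))))).
    cbn_iso; rewrite !comp_assoc.
    etransitivity; [exact (om_assoc_mu (M := word_model) l m n)|].
    symmetry; exact He.
  (* [nil ++ l] computes to [l] and [word_mu nil l] is [lunit], so the transported left unitor is
     the identity. *)
  - intros l; exists eq_refl.
    apply (iso_epic (iso_comp (lunit (word_ev l))
      (iso_tensor (iso_id unit) (iso_id (word_ev l))))).
    cbn_iso; rewrite !comp_assoc.
    etransitivity; [exact (om_lunit_mu (M := word_model) l)|].
    cbn; rewrite tensor_id, comp_id_r, comp_id_l; reflexivity.
  - intros l; destruct (word_mu_runit l) as [e He]; exists e.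
    apply (iso_epic (iso_comp (word_mu l nil)
      (iso_tensor (iso_id (word_ev l)) (iso_id unit)))).
    cbn_iso; rewrite !comp_assoc.
    etransitivity; [exact (om_runit_mu (M := word_model) l)|].
    rewrite tensor_id, comp_id_r; symmetry; exact He.
Qed.

End Words.

Theorem theorem10p17 (C : MarkovCategory) :
  exists D : MarkovCategory, strict_markov D /\ comonoid_equivalent C D.
Proof.
  exists (@om_markov C word_model word_mu_deterministic); split.
  - exact word_strict.
  - apply (@om_comonoid_equivalent C word_model word_mu_deterministic
      (fun X => X :: nil)%list (fun X => runit X)).
    intros X; apply deterministic_runit.
Qed.
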